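(* Let $k$ be a field, let $B$ be a left unital $k$-algebra with left unit $e$, and let $M$ be a left unitary row extension of $B$, with the corresponding $k$-algebra map $\varepsilon:M\to B$. Then the induced map of Hochschild chain complexes $$\mathrm{Tot}\,\mathrm{CC}^{\{1\}}(M)\to\mathrm{Tot}\,\mathrm{CC}^{\{1\}}(B),$$ given in degree $n$ by $\varepsilon^{\otimes(n+1)}$, is surjective, split in the category of graded $k$-modules, and has a contractible kernel; in particular it is a chain homotopy equivalence.
   Context: A left unit of $B$ is an element $e$ with $eb=b$ for all $b\in B$. A row extension of $B$ is a $k$-algebra of the form $$M\cong\begin{pmatrix}B&I\\0&0\end{pmatrix},$$ where $I$ is a left $B$-module (with symmetric $k$-action): as a $k$-module $M=B\oplus I$, with multiplication $(b,i)(b',i')=(bb',bi')$, and $\varepsilon:M\to B$ is $(b,i)\mapsto b$. In particular $B$ is a $k$-subalgebra of $M$ and $I=\ker\varepsilon$ satisfies $IM=0$. It is left unitary if $e$ acts on the left $B$-module $M$ as the identity. For a possibly nonunital $k$-algebra $R$, $\mathrm{Tot}\,\mathrm{CC}^{\{1\}}(R)$ is the complex $R^{\otimes(n+1)}$, $n\ge0$ (tensor products over $k$), with the Hochschild differential $$b(r^0\otimes\cdots\otimes r^n)=\sum_{i=0}^{n-1}(-1)^i r^0\otimes\cdots\otimes r^ir^{i+1}\otimes\cdots\otimes r^n+(-1)^n r^nr^0\otimes r^1\otimes\cdots\otimes r^{n-1}.$$ *)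

(* Defs.v *)
From HB Require Import structures.
From mathcomp Require Import all_boot all_order all_algebra.
From mathcomp Require Import boolp zify.
From mathcomp Require Import finmap.
From mathcomp Require Import monalg.

Set Implicit Arguments.
Unset Strict Implicit.
Unset Printing Implicit Defensive.

Import GRing.Theory.
Local Open Scope ring_scope.
Local Open Scope quotient_scope.

HB.mixin Record Lmodule_isNUAlgebra (k : comNzRingType) A of GRing.Lmodule k A := {
  numul : A -> A -> A;
  numulA : associative numul;
  numul_linl : forall (a : k) (x y z : A),
    numul (a *: x + y) z = a *: numul x z + numul y z;
  numul_linr : forall (a : k) (x y z : A),
    numul z (a *: x + y) = a *: numul z x + numul z y
}.

#[short(type="nuAlgType")]
HB.structure Definition NUAlgebra (k : comNzRingType) :=
  {A of Lmodule_isNUAlgebra k A & GRing.Lmodule k A}.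

Reserved Notation "x ** y" (at level 40, left associativity).
Notation "x ** y" := (numul x y) : ring_scope.

Record nuAlgHom (k : comNzRingType) (A B : nuAlgType k) := NUAlgHom {
  nuhom_linear :> {linear A -> B};
  nuhomM : {morph nuhom_linear : x y / x ** y}
}.

Definition left_unit (k : comNzRingType) (B : nuAlgType k) (e : B) : Prop :=
  forall b : B, e ** b = b.

(* [nuact_linl] and [nuact_linr] together say that the two actions of [k], on
   [B] and on [I], are compatible: (a b) i = a (b i) = b (a i). *)
HB.mixin Record Lmodule_isNULmodule (k : comNzRingType) (B : nuAlgType k) I
    of GRing.Lmodule k I := {
  nuact : B -> I -> I;
  nuactA : forall (b c : B) (i : I), nuact b (nuact c i) = nuact (b ** c) i;
  nuact_linl : forall (a : k) (b c : B) (i : I),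
    nuact (a *: b + c) i = a *: nuact b i + nuact c i;
  nuact_linr : forall (a : k) (b : B) (i j : I),
    nuact b (a *: i + j) = a *: nuact b i + nuact b j
}.

#[short(type="nuLmodType")]
HB.structure Definition NULmodule (k : comNzRingType) (B : nuAlgType k) :=
  {I of Lmodule_isNULmodule k B I & GRing.Lmodule k I}.

(* The algebra of matrices with first row (b, i) and second row (0, 0). *)
Definition row_matrix (k : comNzRingType) (B : nuAlgType k)
  (I : nuLmodType B) : Type := (B * I)%type.

Section RowMatrix.
Variables (k : comNzRingType) (B : nuAlgType k) (I : nuLmodType B).

HB.instance Definition _ := GRing.Lmodule.on (row_matrix I).

Definition row_mul (x y : row_matrix I) : row_matrix I :=
  (x.1 ** y.1, nuact x.1 y.2).

Fact row_mulA : associative row_mul.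
Proof. by move=> [a i] [b j] [c l]; rewrite /row_mul /= numulA nuactA. Qed.

Fact row_mul_linl (a : k) (x y z : row_matrix I) :
  row_mul (a *: x + y) z = a *: row_mul x z + row_mul y z.
Proof.
by case: x y z => [b i] [c j] [d l]; rewrite /row_mul /= numul_linl nuact_linl.
Qed.

Fact row_mul_linr (a : k) (x y z : row_matrix I) :
  row_mul z (a *: x + y) = a *: row_mul z x + row_mul z y.
Proof.
by case: x y z => [b i] [c j] [d l]; rewrite /row_mul /= numul_linr nuact_linr.
Qed.

HB.instance Definition _ := Lmodule_isNUAlgebra.Build k (row_matrix I)
  row_mulA row_mul_linl row_mul_linr.

Definition row_proj (x : row_matrix I) : B := x.1.

Fact row_proj_linear : linear row_proj.
Proof. by []. Qed.

HB.instance Definition _ :=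
  GRing.isLinear.Build k (row_matrix I) B _ row_proj row_proj_linear.

End RowMatrix.

Record row_extension (k : comNzRingType) (B M : nuAlgType k) := RowExtension {
  row_ideal : nuLmodType B;
  row_iso : nuAlgHom M (row_matrix row_ideal);
  row_inv : row_matrix row_ideal -> M;
  row_isoK : cancel row_iso row_inv;
  row_invK : cancel row_inv row_iso
}.
Arguments row_iso {k B M} X : rename.
Arguments row_inv {k B M} X _ : rename.

Section RowExtension.
Variables (k : comNzRingType) (B M : nuAlgType k) (X : row_extension B M).

Definition row_eps_fun : {linear M -> B} :=
  (@row_proj k B (row_ideal X)) \o (row_iso X).

Fact row_eps_mul : {morph row_eps_fun : x y / x ** y}.
Proof. by move=> x y; rewrite /= nuhomM. Qed.

Definition row_eps : nuAlgHom M B := NUAlgHom row_eps_mul.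

Definition row_incl (b : B) : M := row_inv X (b, 0).

Definition left_unitary (e : B) : Prop := forall m : M, row_incl e ** m = m.

End RowExtension.

Section QuotLmodule.
Variables (k : comNzRingType) (V : lmodType k) (S : submodClosed V).

Definition submod_pred : {pred V} := S.

HB.instance Definition _ := GRing.isZmodClosed.Build V submod_pred
  (GRing.submod_closedB (GRing.submodClosedP S)).

Definition lmod_quot : Type := Quotient.quot submod_pred.
HB.instance Definition _ := GRing.Zmodule.on lmod_quot.

Definition lmod_pi (x : V) : lmod_quot := \pi_(Quotient.quot submod_pred) x.

Lemma lmod_pi_eq x y : (lmod_pi x = lmod_pi y) <-> (x - y \in S).
Proof.
rewrite -[x - y \in S]/(x - y \in (submod_pred : zmodClosed V)).
by rewrite Quotient.idealrBE; split=> /eqP.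
Qed.

Fact lmod_piD x y : lmod_pi (x + y) = lmod_pi x + lmod_pi y.
Proof. by rewrite /lmod_pi !piE. Qed.

Lemma lmod_piK (q : lmod_quot) : lmod_pi (repr q) = q.
Proof. exact: reprK. Qed.

Lemma repr_lmod_pi x : x - repr (lmod_pi x) \in S.
Proof. by apply/lmod_pi_eq; rewrite lmod_piK. Qed.

Definition quot_scale (a : k) (q : lmod_quot) : lmod_quot :=
  lmod_pi (a *: repr q).

Fact quot_scale_pi a x : quot_scale a (lmod_pi x) = lmod_pi (a *: x).
Proof.
apply/lmod_pi_eq; rewrite -scalerBr; apply: rpredZ.
by apply/lmod_pi_eq; rewrite lmod_piK.
Qed.

Fact quot_scaleA a b q : quot_scale a (quot_scale b q) = quot_scale (a * b) q.
Proof. by rewrite -(lmod_piK q) !quot_scale_pi scalerA. Qed.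

Fact quot_scale1 : left_id 1 quot_scale.
Proof. by move=> q; rewrite -(lmod_piK q) !quot_scale_pi scale1r. Qed.

Fact quot_scaleDr : right_distributive quot_scale +%R.
Proof.
move=> a q r; rewrite -(lmod_piK q) -(lmod_piK r).
by rewrite -lmod_piD !quot_scale_pi scalerDr lmod_piD.
Qed.

Fact quot_scaleDl q : {morph quot_scale^~ q : a b / a + b}.
Proof.
by move=> a b; rewrite -(lmod_piK q) !quot_scale_pi scalerDl lmod_piD.
Qed.

HB.instance Definition _ := GRing.Zmodule_isLmodule.Build k lmod_quot
  quot_scaleA quot_scale1 quot_scaleDr quot_scaleDl.

Fact lmod_pi_linear : linear lmod_pi.
Proof. by move=> a x y; rewrite lmod_piD -quot_scale_pi. Qed.

HB.instance Definition _ :=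
  GRing.isLinear.Build k V lmod_quot _ lmod_pi lmod_pi_linear.

End QuotLmodule.

Section Upd.
Variables (T : Type) (n : nat).

Definition upd (v : {ffun 'I_n -> T}) (i : 'I_n) (x : T) : {ffun 'I_n -> T} :=
  [ffun j => if j == i then x else v j].

End Upd.

Definition multilinear (k : comNzRingType) n (R V : lmodType k)
    (g : {ffun 'I_n -> R} -> V) : Prop :=
  forall v i (a : k) (x y : R),
    g (upd v i (a *: x + y)) = a *: g (upd v i x) + g (upd v i y).

Section TensorPower.
Variables (k : comNzRingType) (n : nat) (R : lmodType k).

(* The free [k]-module on the set R^n. *)
Let F : lmodType k := malg {ffun 'I_n -> R} k.
Let delta (v : {ffun 'I_n -> R}) : F := @mkmalgU _ k v 1.

Definition multilinear_relation (v : {ffun 'I_n -> R}) (i : 'I_n) (a : k)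
    (x y : R) : F :=
  delta (upd v i (a *: x + y)) - (a *: delta (upd v i x) + delta (upd v i y)).

(* The submodule generated by the relations. *)
Definition multilinear_relations : {pred F} := fun z =>
  `[< forall S : submodClosed F,
        (forall v i a x y, multilinear_relation v i a x y \in S) -> z \in S >].

Fact multilinear_relations_submod : submod_closed multilinear_relations.
Proof.
split=> [|a x y /asboolP hx /asboolP hy]; apply/asboolP=> S hS.
  exact: rpred0.
by apply: rpredD; [apply: rpredZ; apply: hx|apply: hy].
Qed.

HB.instance Definition _ := GRing.isSubmodClosed.Build k F
  multilinear_relations multilinear_relations_submod.

Definition tensor_power : lmodType k := lmod_quot multilinear_relations.

Definition pure (v : {ffun 'I_n -> R}) : tensor_power :=
  lmod_pi multilinear_relations (delta v).

Lemma pure_multilinear : multilinear pure.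
Proof.
move=> v i a x y; rewrite /pure -linearP; apply/lmod_pi_eq.
by apply/asboolP=> S; apply.
Qed.


Definition tensor_repr (t : tensor_power) : F :=
  repr (t : lmod_quot multilinear_relations).

Lemma tensor_pure_sum (t : tensor_power) :
  t = \sum_(v <- msupp (tensor_repr t)) mcoeff v (tensor_repr t) *: pure v.
Proof.
rewrite -[LHS](lmod_piK t) [X in lmod_pi _ X]monalgE raddf_sum.
apply: eq_bigr => v _; rewrite -linearZ; congr (lmod_pi _ _).
apply/malgP => w.
by rewrite mcoeffZ !mcoeffU mulrnAr mulr1.
Qed.

Section Lift.
Variables (V : lmodType k) (g : {ffun 'I_n -> R} -> V).

Let free_lift (z : F) : V :=
  \sum_(v <- msupp z) mcoeff v z *: g v.

Let free_liftEw (z : F) (D : {fset {ffun 'I_n -> R}}) :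
  (msupp z `<=` D)%fset ->
  free_lift z = \sum_(v <- D) mcoeff v z *: g v.
Proof.
move=> sD; rewrite /free_lift; apply: big_fset_incl => // v _ vz.
by rewrite mcoeff_outdom // scale0r.
Qed.

Let free_lift_linear : linear free_lift.
Proof.
move=> a x y.
set D := (msupp x `|` msupp y `|` msupp (a *: x + y))%fset.
have sx : (msupp x `<=` D)%fset by rewrite /D -fsetUA fsubsetUl.
have sy : (msupp y `<=` D)%fset by rewrite /D fsetUAC fsubsetUr.
have sz : (msupp (a *: x + y) `<=` D)%fset by rewrite /D fsubsetUr.
rewrite (free_liftEw sx) (free_liftEw sy) (free_liftEw sz).
rewrite scaler_sumr -big_split; apply: eq_bigr => v _ /=.
by rewrite mcoeffD mcoeffZ scalerDl scalerA.
Qed.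

Let free_lift_delta v : free_lift (delta v) = g v.
Proof.
rewrite /free_lift msuppU oner_eq0 big_seq_fset1.
by rewrite mcoeffUU scale1r.
Qed.

HB.instance Definition _ :=
  GRing.isLinear.Build k F V _ free_lift free_lift_linear.

Hypothesis gP : multilinear g.

Let free_lift_ker : {pred F} := fun z => free_lift z == 0.

Let free_lift_ker_submod : submod_closed free_lift_ker.
Proof.
split=> [|a x y /eqP hx /eqP hy]; apply/eqP; first exact: raddf0.
by rewrite linearP /= hx hy scaler0 addr0.
Qed.

HB.instance Definition _ := GRing.isSubmodClosed.Build k F
  free_lift_ker free_lift_ker_submod.

Let free_lift_rel (z : F) : z \in multilinear_relations -> free_lift z = 0.
Proof.
move=> /asboolP hz; apply/eqP; apply: (hz free_lift_ker) => v i a x y.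
apply/eqP; rewrite /multilinear_relation raddfB /= linearP /= !free_lift_delta.
by rewrite gP subrr.
Qed.

Definition tensor_lift_fun of multilinear g := fun t : tensor_power =>
  free_lift (tensor_repr t).

Fact tensor_lift_pi z : tensor_lift_fun gP (lmod_pi _ z) = free_lift z.
Proof.
apply/esym/eqP; rewrite -subr_eq0 -raddfB; apply/eqP/free_lift_rel.
exact: repr_lmod_pi.
Qed.

Fact tensor_lift_linear : linear (tensor_lift_fun gP).
Proof.
move=> a x y; rewrite -(lmod_piK x) -(lmod_piK y) -linearP.
by rewrite !tensor_lift_pi linearP.
Qed.

HB.instance Definition _ :=
  GRing.isLinear.Build k (lmod_quot multilinear_relations) V _
    (tensor_lift_fun gP) tensor_lift_linear.

Definition tensor_lift : {linear tensor_power -> V} := tensor_lift_fun gP.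

Lemma tensor_liftE v : tensor_lift (pure v) = g v.
Proof. by rewrite /tensor_lift /= tensor_lift_pi free_lift_delta. Qed.

End Lift.

Lemma tensor_linear_eq (V : lmodType k) (f g : {linear tensor_power -> V}) :
  (forall v, f (pure v) = g (pure v)) -> f =1 g.
Proof.
move=> fg t; rewrite (tensor_pure_sum t) !raddf_sum.
by apply: eq_bigr => v _ /=; rewrite !linearZ /= fg.
Qed.

End TensorPower.

(* Affects unification only, which otherwise gets lost in the quotient; use
   [tensor_liftE] and [tensor_linear_eq] instead of unfolding. *)
#[global] Opaque tensor_power pure tensor_lift.

Section TensorMap.
Variables (k : comNzRingType) (n : nat) (R S : lmodType k).
Variable f : {linear R -> S}.

Definition pure_map (v : {ffun 'I_n -> R}) : tensor_power n S :=
  pure [ffun i => f (v i)].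

Fact pure_map_multilinear : multilinear pure_map.
Proof.
move=> v i a x y; rewrite /pure_map.
have updf z : [ffun j => f (upd v i z j)] = upd [ffun j => f (v j)] i (f z).
  by apply/ffunP => j; rewrite !ffunE; case: eqP.
by rewrite !updf linearP pure_multilinear.
Qed.

Definition tensor_map : {linear tensor_power n R -> tensor_power n S} :=
  tensor_lift pure_map_multilinear.

Lemma tensor_mapE v : tensor_map (pure v) = pure [ffun i => f (v i)].
Proof. exact: tensor_liftE. Qed.

End TensorMap.

Record chain_complex (k : comNzRingType) := ChainComplex {
  chain :> nat -> lmodType k;
  diff : forall n, {linear chain n.+1 -> chain n};
  diffK : forall n x, diff n (diff n.+1 x) = 0
}.
Arguments diff {k} c n.

Record chain_map (k : comNzRingType) (C D : chain_complex k) := ChainMap {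
  chain_map_fun :> forall n, {linear C n -> D n};
  chain_mapP : forall n x,
    chain_map_fun n (diff C n x) = diff D n (chain_map_fun n.+1 x)
}.

Section ChainComplexes.
Variable k : comNzRingType.
Implicit Types C D E : chain_complex k.

Definition chain_id C : chain_map C C :=
  @ChainMap k C C (fun n => idfun) (fun n x => erefl).

Fact chain_zeroP C D n x :
  (\0 : C n -> D n) (diff C n x) = diff D n ((\0 : C n.+1 -> D n.+1) x).
Proof. by rewrite /= linear0. Qed.

Definition chain_zero C D : chain_map C D :=
  @ChainMap k C D (fun n => \0) (@chain_zeroP C D).

Fact chain_compP C D E (g : chain_map D E) (f : chain_map C D) n x :
  (g n \o f n) (diff C n x) = diff E n ((g n.+1 \o f n.+1) x).
Proof. by rewrite /= !chain_mapP. Qed.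

Definition chain_comp C D E (g : chain_map D E) (f : chain_map C D) :
  chain_map C E :=
  @ChainMap k C E (fun n => g n \o f n) (@chain_compP C D E g f).

Definition chain_homotopic C D (f g : chain_map C D) : Prop :=
  exists h : forall n, {linear C n -> D n.+1},
    (forall x, f 0%N x - g 0%N x = diff D 0 (h 0%N x)) /\
    (forall n x, f n.+1 x - g n.+1 x =
       diff D n.+1 (h n.+1 x) + h n (diff C n x)).

Definition chain_homotopy_equivalence C D (f : chain_map C D) : Prop :=
  exists g : chain_map D C,
    chain_homotopic (chain_comp g f) (chain_id C) /\
    chain_homotopic (chain_comp f g) (chain_id D).

Definition contractible C : Prop :=
  chain_homotopic (chain_id C) (chain_zero C C).

Definition degreewise_surjective C D (f : chain_map C D) : Prop :=
  forall n (y : D n), exists x : C n, f n x = y.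

(* The section is [k]-linear in each degree, but need not commute with the
   differentials. *)
Definition graded_split C D (f : chain_map C D) : Prop :=
  exists s : forall n, {linear D n -> C n}, forall n, cancel (s n) (f n).

End ChainComplexes.

Section Kernel.
Variables (k : comNzRingType) (V W : lmodType k) (f : {linear V -> W}).

Definition ker_pred : {pred V} := fun x => f x == 0.

Fact ker_pred_submod : submod_closed ker_pred.
Proof.
split=> [|a x y /eqP hx /eqP hy]; apply/eqP; first exact: raddf0.
by rewrite linearP /= hx hy scaler0 addr0.
Qed.

HB.instance Definition _ := GRing.isSubmodClosed.Build k V
  ker_pred ker_pred_submod.

Record ker_type := Ker { ker_val : V; ker_valP : ker_val \in ker_pred }.

HB.instance Definition _ := [isSub for ker_val].
HB.instance Definition _ := [Choice of ker_type by <:].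
HB.instance Definition _ := [SubChoice_isSubLmodule of ker_type by <:].

End Kernel.

Section KernelComplex.
Variables (k : comNzRingType) (C D : chain_complex k) (f : chain_map C D).

Definition ker_chain n : lmodType k := ker_type (f n).

Fact ker_diff_subproof n (x : ker_chain n.+1) :
  diff C n (val x) \in ker_pred (f n).
Proof. by apply/eqP; rewrite chain_mapP (eqP (valP x)) linear0. Qed.

Definition ker_diff n (x : ker_chain n.+1) : ker_chain n :=
  Ker (ker_diff_subproof x).

Fact ker_diff_linear n : linear (@ker_diff n).
Proof. by move=> a x y; apply: val_inj; rewrite /= !linearP. Qed.

HB.instance Definition _ n := GRing.isLinear.Build k (ker_chain n.+1)
  (ker_chain n) _ (@ker_diff n) (@ker_diff_linear n).

Fact ker_diffK n (x : ker_chain n.+2) : ker_diff (ker_diff x) = 0.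
Proof. by apply: val_inj; rewrite /= diffK. Qed.

Definition ker_complex : chain_complex k :=
  @ChainComplex k ker_chain (fun n => @ker_diff n) ker_diffK.

End KernelComplex.

Section HochschildDifferential.
Variables (k : comNzRingType) (R : nuAlgType k) (n : nat).
Implicit Type r : {ffun 'I_n.+2 -> R}.

(* (r_0, ..., r_i r_(i+1), ..., r_(n+1)) *)
Definition contract (i : 'I_n.+1) r : {ffun 'I_n.+1 -> R} :=
  [ffun j : 'I_n.+1 =>
    if (j < i)%N then r (widen_ord (leqnSn _) j)
    else if j == i then r (widen_ord (leqnSn _) j) ** r (lift ord0 j)
    else r (lift ord0 j)].

(* (r_(n+1) r_0, r_1, ..., r_n) *)
Definition wrap r : {ffun 'I_n.+1 -> R} :=
  [ffun j : 'I_n.+1 =>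
    if j == ord0 then r ord_max ** r ord0 else r (widen_ord (leqnSn _) j)].

Definition hochschild_pure r : tensor_power n.+1 R :=
  \sum_(i < n.+1) (-1) ^+ i *: pure (contract i r)
  + (-1) ^+ n.+1 *: pure (wrap r).


Ltac upd_tac i l m :=
  apply/ffunP => j; have lt_j := ltn_ord j; rewrite !ffunE -?val_eqE /= ?/bump ?leq0n ?add1n ?m;
  repeat (match goal with |- context [if ?b then _ else _] =>
    lazymatch b with context [if _ then _ else _] => fail | _ => idtac end;
    let h := fresh "h" in case: (boolP b) => h end);
  try (exfalso; lia); do ?[congr (_ ** _)]; try reflexivity;
  try (congr (fun_of_fin _ _); apply: val_inj => /=; rewrite /bump /=; lia).


Lemma contract_upd i r l : exists m (phi : R -> R), linear phi /\
  forall x, contract i (upd r l x) = upd (contract i r) m (phi x).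
Proof.
have lt_l := ltn_ord l; have lt_i := ltn_ord i.
have lE p : (p < n.+1)%N -> (inord p : 'I_n.+1) = p :> nat by apply: (@inordK n).
case: (ltngtP l i) => [li|il|eli].
- exists (inord l), id; split=> // x; have m := lE l ltac:(lia); upd_tac i l m.
- have [l1|l1] := eqVneq (l : nat) i.+1.
    exists i, (fun x => r (widen_ord (leqnSn _) i) ** x).
    split=> [a x y|x]; [exact: numul_linr|upd_tac i l l1].
  exists (inord l.-1), id; split=> // x.
  have m := lE l.-1 ltac:(lia); upd_tac i l m.
- exists i, (fun x => x ** r (lift ord0 i)).
  split=> [a x y|x]; [exact: numul_linl|upd_tac i l eli].
Qed.


Lemma wrap_upd r l : exists m (phi : R -> R), linear phi /\
  forall x, wrap (upd r l x) = upd (wrap r) m (phi x).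
Proof.
have lt_l := ltn_ord l.
have lE p : (p < n.+1)%N -> (inord p : 'I_n.+1) = p :> nat by apply: (@inordK n).
have [l0|l0] := eqVneq (l : nat) 0%N.
  exists ord0, (fun x => r ord_max ** x).
  split=> [a x y|x]; [exact: numul_linr|upd_tac l l l0].
have [lN|lN] := eqVneq (l : nat) n.+1.
  exists ord0, (fun x => x ** r ord0).
  split=> [a x y|x]; [exact: numul_linl|upd_tac l l lN].
exists (inord l), id; split=> // x; have m := lE l ltac:(lia); upd_tac l l m.
Qed.

Fact hochschild_pure_multilinear : multilinear hochschild_pure.
Proof.
move=> r l a x y; rewrite /hochschild_pure scalerDr addrACA; congr (_ + _).
  rewrite scaler_sumr -big_split; apply: eq_bigr => i _ /=.
  have [m [phi [phiP E]]] := contract_upd i r l.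
  by rewrite !E phiP pure_multilinear scalerDr !scalerA mulrC.
have [m [phi [phiP E]]] := wrap_upd r l.
by rewrite !E phiP pure_multilinear scalerDr !scalerA mulrC.
Qed.

Definition hochschild_diff :
    {linear tensor_power n.+2 R -> tensor_power n.+1 R} :=
  tensor_lift hochschild_pure_multilinear.

Lemma hochschild_diffE r : hochschild_diff (pure r) = hochschild_pure r.
Proof. exact: tensor_liftE. Qed.

End HochschildDifferential.

Section HochschildComplex.
Variables (k : comNzRingType) (R : nuAlgType k).

(* The face maps on sequences [u 0, ..., u N], used to prove [b b = 0] *)
Let seqface N i (u : nat -> R) m : R :=
  if i == N then if m == 0%N then u N ** u 0%N else u m
  else if (m < i)%N then u m else if m == i then u m ** u m.+1 else u m.+1.

Let seqfaceK N i j u m : (0 < N)%N -> (i < j <= N.+1)%N -> (m < N)%N ->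
  seqface N i (seqface N.+1 j u) m = seqface N j.-1 (seqface N.+1 i u) m.
Proof.
move=> N0 /andP[ij jN] mN; rewrite /seqface.
repeat (match goal with |- context [if ?b then _ else _] =>
    lazymatch b with context [if _ then _ else _] => fail | _ => idtac end;
    let h := fresh "h" in case: (boolP b) => h; try (exfalso; lia) end);
  rewrite ?numulA; do ?[congr (_ ** _)]; try reflexivity;
  try (congr (u _); lia).
Qed.

Let to_seq n (r : {ffun 'I_n.+1 -> R}) (m : nat) : R := r (inord m).

Let face n (i : 'I_n.+2) (r : {ffun 'I_n.+2 -> R}) : {ffun 'I_n.+1 -> R} :=
  [ffun j : 'I_n.+1 => seqface n.+1 i (to_seq r) j].

Let to_seq_face n (i : 'I_n.+2) r m : (m < n.+1)%N ->
  to_seq (face i r) m = seqface n.+1 i (to_seq r) m.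
Proof. by move=> mn; rewrite /to_seq ffunE inordK. Qed.

Let contract_face n (i : 'I_n.+1) (r : {ffun 'I_n.+2 -> R}) :
  contract i r = face (widen_ord (leqnSn _) i) r.
Proof.
apply/ffunP => j; rewrite !ffunE /seqface /to_seq /=.
have lt_i := ltn_ord i; have lt_j := ltn_ord j.
have wE : widen_ord (leqnSn _) j = inord j.
  by apply: val_inj; rewrite /= inordK; lia.
have lE : lift ord0 j = inord j.+1.
  by apply: val_inj; rewrite /= inordK /bump; lia.
by rewrite ltn_eqF // wE lE.
Qed.

Let wrap_face n (r : {ffun 'I_n.+2 -> R}) : wrap r = face ord_max r.
Proof.
apply/ffunP => j; rewrite !ffunE /seqface /to_seq /= eqxx.
have lt_j := ltn_ord j.
have wE : widen_ord (leqnSn _) j = inord j.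
  by apply: val_inj; rewrite /= inordK; lia.
have ->: ord_max = inord n.+1 :> 'I_n.+2 by apply: val_inj; rewrite /= inordK.
have ->: ord0 = inord 0 :> 'I_n.+2 by apply: val_inj; rewrite /= inordK.
by rewrite wE -val_eqE.
Qed.

Let hochschild_pure_face n (r : {ffun 'I_n.+2 -> R}) :
  hochschild_pure r = \sum_(i < n.+2) (-1) ^+ i *: pure (face i r).
Proof.
rewrite /hochschild_pure wrap_face [RHS]big_ord_recr; congr (_ + _).
by apply: eq_bigr => i _; rewrite contract_face.
Qed.

Let faceK n (i j : nat) (r : {ffun 'I_n.+3 -> R}) : (i < j <= n.+2)%N ->
  face (inord i) (face (inord j) r) = face (inord j.-1) (face (inord i) r).
Proof.
move=> /andP[ij jn]; apply/ffunP => m; rewrite !ffunE.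
have seqE (f : 'I_n.+3) p : (p < n.+2)%N ->
    to_seq (face f r) p = seqface n.+2 f (to_seq r) p by apply: to_seq_face.
have E (f : 'I_n.+3) g p : (p < n.+1)%N ->
    seqface n.+1 g (to_seq (face f r)) p =
    seqface n.+1 g (seqface n.+2 f (to_seq r)) p.
  by move=> hp; rewrite /seqface !seqE //; lia.
rewrite !E ?ltn_ord // !inordK; try lia.
by rewrite seqfaceK //; apply/andP; split=> //; lia.
Qed.

Let alternating_sum (V : zmodType) N (a : nat -> nat -> V) :
  (forall i j, (i < j <= N)%N -> a i j = - a j.-1 i) ->
  \sum_(j < N.+1) \sum_(i < N) a i j = 0.
Proof.
move=> aP.
have split_sum (j : nat) : \sum_(i < N) a i j =
    \sum_(i < N | (i < j)%N) a i j + \sum_(i < N | (j <= i)%N) a i j.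
  rewrite (bigID (fun i : 'I_N => (i < j)%N)) /=; congr (_ + _).
  by apply: eq_bigl => i; rewrite -leqNgt.
under eq_bigr do rewrite split_sum.
rewrite big_split /= big_ord_recl big_pred0 // add0r.
rewrite [X in _ + X]big_ord_recr /= [X in _ + (_ + X)]big_pred0; last first.
  by move=> i; rewrite leqNgt ltn_ord.
rewrite addr0; under eq_bigr => j _ do under eq_bigr => i ij do
  rewrite aP ?ij ?ltn_ord //=.
rewrite [X in _ + X](exchange_big_dep xpredT) //= -big_split big1 // => j _.
rewrite /= sumrN addrC; apply/eqP; rewrite subr_eq0; apply/eqP.
by apply: eq_bigl => i; rewrite ?ltnS.
Qed.

Fact hochschild_diffK n (x : tensor_power n.+3 R) :
  hochschild_diff R n (hochschild_diff R n.+1 x) = 0.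
Proof.
pose z : {linear tensor_power n.+3 R -> tensor_power n.+1 R} := \0.
rewrite -[RHS]/(z x).
apply: (@tensor_linear_eq _ _ _ _ (hochschild_diff R n \o hochschild_diff R n.+1) z).
move=> r; rewrite /= hochschild_diffE hochschild_pure_face raddf_sum /=.
pose a (i j : nat) : tensor_power n.+1 R :=
  (-1) ^+ (i + j) *: pure (face (inord i) (face (inord j) r)).
transitivity (\sum_(j < n.+3) \sum_(i < n.+2) a i j).
  apply: eq_bigr => j _; rewrite linearZ /= hochschild_diffE.
  rewrite hochschild_pure_face scaler_sumr; apply: eq_bigr => i _.
  by rewrite scalerA -exprD addnC /a !inord_val.
apply: alternating_sum => i j /andP[ij jn]; rewrite /a -scaleNr.
have -> : face (inord i) (face (inord j) r) =
    face (inord j.-1) (face (inord i) r) :> {ffun 'I_n.+1 -> R}.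
  by apply: faceK; apply/andP.
congr (_ *: _).
have -> : (i + j = (j.-1 + i).+1)%N by lia.
by rewrite exprS mulN1r.
Qed.

(* The complex Tot CC^{1}(R), with the (n+1)-fold tensor power of R in degree
   n. *)
Definition hochschild : chain_complex k :=
  @ChainComplex k (fun n => tensor_power n.+1 R) (hochschild_diff R)
    hochschild_diffK.

End HochschildComplex.

Section HochschildMap.
Variables (k : comNzRingType) (R S : nuAlgType k) (f : nuAlgHom R S).

Fact hochschild_mapP n (x : hochschild R n.+1) :
  tensor_map n.+1 f (diff (hochschild R) n x) =
  diff (hochschild S) n (tensor_map n.+2 f x).
Proof.
apply: (@tensor_linear_eq _ _ _ _ (tensor_map n.+1 f \o hochschild_diff R n)
  (hochschild_diff S n \o tensor_map n.+2 f)) => r.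
rewrite /= tensor_mapE !hochschild_diffE linearD /= raddf_sum linearZ /=.
rewrite tensor_mapE /hochschild_pure; congr (_ + _ *: pure _).
  apply: eq_bigr => i _; rewrite linearZ /= tensor_mapE.
  congr (_ *: pure _); apply/ffunP => j; rewrite !ffunE.
  by do 2?case: ifP => // _; rewrite nuhomM.
by apply/ffunP => j; rewrite !ffunE; case: ifP => // _; rewrite nuhomM.
Qed.

Definition hochschild_map : chain_map (hochschild R) (hochschild S) :=
  @ChainMap k (hochschild R) (hochschild S) (fun n => tensor_map n.+1 f)
    hochschild_mapP.

End HochschildMap.

(* Main.v *)
(* Let [p : M -> M] be [eps] followed by the inclusion of [B].  Since [I M = 0],
   [p x ** y = x ** y].  Define [h_j (x_0, ..., x_n)] to be
   [(p x_0, ..., p x_(j-1), x_j - p x_j, e, x_(j+1), ..., x_n)]: on a tensor with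
   factors in [B] or [I], [h_j] vanishes unless [x_j] is the first factor in [I],
   and then it inserts [e] right after it.  The faces of [h_j] satisfy
   [d_i h_j = h_(j-1) d_i] for [i < j], [d_j h_j = 0], [d_i h_j = h_j d_(i-1)] for
   [i > j + 1], while [d_(j+1) h_j] is the difference of
   [(p x_0, ..., p x_(j-1), x_j, ..., x_n)] and [(p x_0, ..., p x_j, x_(j+1), ..., x_n)].
   Hence [h = sum_j (-1)^(j+1) h_j] is a homotopy from the identity to the map
   induced by [p], and [eps h = 0], so [h] also contracts the kernel. *)
From HB Require Import structures.
Require Import Defs.
From mathcomp Require Import all_boot all_order all_algebra.
From mathcomp Require Import zify.

Set Implicit Arguments.
Unset Strict Implicit.
Unset Printing Implicit Defensive.

Import GRing.Theory.
Local Open Scope ring_scope.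

(** * Formal consequences of a chain section and a homotopy with image in the kernel *)

Section SplitHomotopy.
Variables (k : comNzRingType) (C D : chain_complex k).
Variables (f : chain_map C D) (s : chain_map D C).
Variable h : forall n, {linear C n -> C n.+1}.
Hypothesis sK : forall n, cancel (s n) (f n).
Hypothesis h0 : forall x, x - s 0%N (f 0%N x) = diff C 0 (h 0%N x).
Hypothesis hS : forall n x,
  x - s n.+1 (f n.+1 x) = diff C n.+1 (h n.+1 x) + h n (diff C n x).
Hypothesis fh : forall n x, f n.+1 (h n x) = 0.

Lemma section_surjective : degreewise_surjective f.
Proof. by move=> n y; exists (s n y); exact: sK. Qed.

Lemma section_graded_split : graded_split f.
Proof. by exists (fun n => s n). Qed.

Fact ker_homotopy_subproof n (x : ker_chain f n) :
  h n (val x) \in ker_pred (f n.+1).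
Proof. by apply/eqP; rewrite fh. Qed.

Definition ker_homotopy n (x : ker_chain f n) : ker_chain f n.+1 :=
  Ker (ker_homotopy_subproof x).

Fact ker_homotopy_linear n : linear (@ker_homotopy n).
Proof. by move=> a x y; apply: val_inj; rewrite /= !linearP. Qed.

HB.instance Definition _ n := GRing.isLinear.Build k (ker_chain f n)
  (ker_chain f n.+1) _ (@ker_homotopy n) (@ker_homotopy_linear n).

(** On the kernel the term [s (f x)] vanishes, so the homotopy relation reads [x = d h x + h d x];
    [fh] is what lets [h] restrict. *)
Lemma ker_contractible : contractible (ker_complex f).
Proof.
have fx n (x : ker_chain f n) : f n (val x) = 0 by apply/eqP/(valP x).
exists (fun n => @ker_homotopy n); split=> [x|n x]; apply: val_inj => /=.
  by rewrite subr0 -h0 fx linear0 subr0.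
by rewrite subr0 -hS fx linear0 subr0.
Qed.

(** The inverse is [s]. Since [f s] is the identity, one homotopy is zero; the other is [- h],
    because [s f] is compared with the identity in that order. *)
Lemma section_homotopy_equivalence : chain_homotopy_equivalence f.
Proof.
exists s; split.
  exists (fun n => \- h n); split=> [x|n x] /=.
    by rewrite linearN /= -h0 opprB.
  by rewrite linearN /= -opprD -hS opprB.
exists (fun n => \0); split=> [x|n x] /=.
  by rewrite sK subrr linear0.
by rewrite sK subrr linear0 addr0.
Qed.

End SplitHomotopy.

(** * Pure tensors as words *)

Section Words.
Variables (k : comNzRingType) (V : lmodType k).
Implicit Types u v w : nat -> V.

(** Letters are indexed by all of [nat], so that faces and insertions are plain index arithmetic
    without casts between ordinals; only the first [n] letters count. *)
Definition word n u : tensor_power n V := pure [ffun i : 'I_n => u i].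

Definition letters n (r : {ffun 'I_n.+1 -> V}) (m : nat) : V := r (inord m).

Lemma pure_letters n (r : {ffun 'I_n.+1 -> V}) : pure r = word n.+1 (letters r).
Proof. by congr pure; apply/ffunP=> i; rewrite ffunE /letters inord_val. Qed.

Lemma eq_word n u v : (forall m, (m < n)%N -> u m = v m) -> word n u = word n v.
Proof. by move=> uv; congr pure; apply/ffunP=> i; rewrite !ffunE uv. Qed.

Lemma wordD n u v w j : (j < n)%N -> u j = v j + w j ->
  (forall m, (m < n)%N -> m != j -> u m = v m /\ w m = v m) ->
  word n u = word n v + word n w.
Proof.
move=> jn uj uvw; pose r : {ffun 'I_n -> V} := [ffun i : 'I_n => v i].
pose i := Ordinal jn.
have := pure_multilinear r i 1 (v j) (w j); rewrite !scale1r -uj => E.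
rewrite /word; transitivity (pure (upd r i (u j))).
  congr pure; apply/ffunP=> l; rewrite !ffunE -val_eqE /=.
  by case: eqP => [->//|/eqP h]; case: (uvw l).
rewrite E; congr (pure _ + pure _); apply/ffunP=> l; rewrite !ffunE -val_eqE /=.
  by case: eqP => [->|].
by case: eqP => [->//|/eqP h]; case: (uvw l) => // _ ->.
Qed.

(** Splitting the zero letter as [0 + 0] gives [word n u = word n u + word n u]. *)
Lemma word0 n u j : (j < n)%N -> u j = 0 -> word n u = 0.
Proof.
move=> jn uj; apply: (addrI (word n u)); rewrite addr0; apply/esym.
by apply: (@wordD n u u u j); rewrite // uj addr0.
Qed.

End Words.

Lemma tensor_map_word (k : comNzRingType) (V W : lmodType k)
    (f : {linear V -> W}) n (u : nat -> V) :
  tensor_map n f (word n u) = word n (f \o u).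
Proof. by rewrite tensor_mapE; congr pure; apply/ffunP=> i; rewrite !ffunE. Qed.

(** * The Hochschild differential as an alternating sum of faces *)

Section Faces.
Variables (k : comNzRingType) (R : nuAlgType k).
Implicit Types u : nat -> R.

(* The face with [i = N] is the cyclic one, which multiplies [u N] by [u 0]. *)
Definition face N i u (m : nat) : R :=
  if i == N then if m == 0%N then u N ** u 0%N else u m
  else if (m < i)%N then u m else if m == i then u m ** u m.+1 else u m.+1.

Lemma contract_word n (i : 'I_n.+1) u :
  contract i [ffun m : 'I_n.+2 => u m] = [ffun m : 'I_n.+1 => face n.+1 i u m].
Proof.
apply/ffunP=> j; have lt_i := ltn_ord i.
by rewrite !ffunE /face (ltn_eqF lt_i) -val_eqE /= /bump leq0n add1n.
Qed.

Lemma wrap_word n u :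
  Defs.wrap [ffun m : 'I_n.+2 => u m] = [ffun m : 'I_n.+1 => face n.+1 n.+1 u m].
Proof. by apply/ffunP=> j; rewrite !ffunE /face eqxx -val_eqE. Qed.

Lemma hochschild_diff_word n u :
  hochschild_diff R n (word n.+2 u) =
  \sum_(i < n.+2) (-1) ^+ i *: word n.+1 (face n.+1 i u).
Proof.
rewrite /word hochschild_diffE /hochschild_pure wrap_word [RHS]big_ord_recr.
by under eq_bigr do rewrite contract_word.
Qed.

End Faces.

(* [F] stands for the signed [d_i h_j], and [G] for the signed [h_j d_i]. *)
Lemma insertion_double_sum (V : zmodType) n (F G : nat -> nat -> V) (T : nat -> V) :
  (forall i j, (i < j <= n)%N -> F i j = - G i j.-1) ->
  (forall j, (j <= n)%N -> F j j = 0) ->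
  (forall j, (j <= n)%N -> F j.+1 j = T j - T j.+1) ->
  (forall i j, (j < i <= n)%N -> F i.+1 j = - G i j) ->
  \sum_(j < n.+1) \sum_(i < n.+2) F i j + \sum_(j < n) \sum_(i < n.+1) G i j =
  T 0%N - T n.+1.
Proof.
move=> Flt Feq Fsucc Fgt.
(* For fixed [j], cut the range of [i] at the two special faces [j] and [j.+1]; the remaining faces
   contribute terms of [G]. *)
have E j : (j < n.+1)%N -> \sum_(i < n.+2) F i j =
    (T j - T j.+1) - (\sum_(0 <= i < j) G i j.-1 + \sum_(j.+1 <= i < n.+1) G i j).
  move=> jn; rewrite -(big_mkord xpredT (fun i => F i j)).
  rewrite (big_cat_nat (n := j)) //=; last lia.
  rewrite [X in _ + X = _]big_ltn; last lia.
  rewrite [X in _ + (_ + X) = _]big_ltn; last lia.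
  rewrite Feq // add0r Fsucc // big_add1 /= addrCA; congr (_ + _).
  rewrite opprD -!sumrN; congr (_ + _); apply: eq_big_nat => i hi.
    by rewrite Flt //; lia.
  by rewrite Fgt //; lia.
under eq_bigr => j _ do rewrite (E j (ltn_ord j)).
rewrite sumrB [X in _ - X]big_split /=.
(* The lower part is empty at [j = 0] and the upper part at [j = n]. After a shift of the former,
   both run over [j < n], and together they fill the whole range of [i]. *)
rewrite [X in _ - (X + _)]big_ord_recl /= big_geq // add0r.
rewrite [X in _ - (_ + X)]big_ord_recr /= big_geq // addr0.
rewrite -big_split /=.
rewrite -[RHS]addr0 -addrA; congr (_ + _).
  rewrite -(big_mkord xpredT (fun j => T j - T j.+1)).
  under eq_big_nat do rewrite -opprB.
  by rewrite sumrN telescope_sumr // opprB.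
rewrite addrC; apply/eqP; rewrite subr_eq0; apply/eqP.
apply: eq_bigr => j _; rewrite -(big_mkord xpredT (fun i => G i j)).
rewrite (big_cat_nat (n := j.+1)) //=.
by have := ltn_ord j; lia.
Qed.

(** * The homotopy that inserts the left unit *)

Section Insertion.
Variables (k : comNzRingType) (M : nuAlgType k) (e : M) (p : nuAlgHom M M).
Hypothesis e1 : left_unit e.
Hypothesis pM : forall x y : M, p x ** y = x ** y.
Implicit Types u v : nat -> M.

Definition insert j u (m : nat) : M :=
  if (m < j)%N then p (u m) else if m == j then u m - p (u m)
  else if m == j.+1 then e else u m.-1.

(** Interpolates between the identity, at [j = 0], and [p] on all [n] letters, at [j = n]; the words
    of these sequences form the telescoping sum. *)
Definition head_map j u (m : nat) : M := if (m < j)%N then p (u m) else u m.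

Lemma mulBl (x y z : M) : (x - y) ** z = x ** z - y ** z.
Proof. by have := numul_linl (-1) y x z; rewrite !scaleN1r ![- _ + _]addrC. Qed.

Lemma mulBr (x y z : M) : x ** (y - z) = x ** y - x ** z.
Proof. by have := numul_linr (-1) z y x; rewrite !scaleN1r ![- _ + _]addrC. Qed.

Ltac split_ifs :=
  repeat match goal with |- context [if ?b then _ else _] =>
    lazymatch b with context [if _ then _ else _] => fail | _ => idtac end;
    let h := fresh "h" in case: (boolP b) => h; try (exfalso; lia) end.

Ltac solve_letters u :=
  rewrite /face /insert /head_map; split_ifs;
  rewrite ?nuhomM ?mulBl ?mulBr ?pM ?e1 ?nuhomM ?pM ?subrr //;
  repeat first [reflexivity | congr (u _); lia | congr (p _) | congr (_ - _)
               | congr (_ ** _)].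

(** The critical case is [i = j - 1]: both sides have the letter [u i ** u j - u i ** p (u j)],
    because [p] is multiplicative and [pM] removes [p] from left factors. *)
Lemma face_insert_lt n i j u m : (i < j <= n)%N -> (m < n.+1)%N ->
  face n.+1 i (insert j u) m = insert j.-1 (face n i u) m.
Proof. move=> /andP[ij jn] mn; solve_letters u. Qed.

(** For [i = n] both faces are cyclic, and the first letters agree because
    [p (u n ** u 0) = u n ** p (u 0)]. *)
Lemma face_insert_gt n i j u m : (j < i <= n)%N -> (m < n.+1)%N ->
  face n.+1 i.+1 (insert j u) m = insert j (face n i u) m.
Proof. move=> /andP[ij jn] mn; solve_letters u. Qed.

(** The letter is [(u j - p (u j)) ** e], which [pM] kills. *)
Lemma face_insert_eq n j u : (j <= n)%N -> face n.+1 j (insert j u) j = 0.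
Proof. move=> jn; solve_letters u. Qed.

(** The inserted [e] is absorbed by the letter after it, or, when [j = n], cyclically by the first
    letter; both use that [e] is a left unit. *)
Lemma face_insert_succ n j u m : (j <= n)%N -> (m < n.+1)%N -> (m != j)%N ->
  face n.+1 j.+1 (insert j u) m = head_map j u m.
Proof. move=> jn mn mj; solve_letters u. Qed.

Lemma face_insert_succ_diag n j u : (j <= n)%N ->
  face n.+1 j.+1 (insert j u) j = u j - p (u j).
Proof. move=> jn; solve_letters u. Qed.

Ltac insert_upd_cases lettersE :=
  apply/ffunP=> i; have lt_i := ltn_ord i; rewrite !ffunE -val_eqE /= ?/bump /insert;
  split_ifs; rewrite ?lettersE //; try lia; split_ifs.

(** Each input letter [l] governs a single output letter: position [l] through [p] if [l < j],
    position [l + 1] unchanged if [l > j], and position [j] through [x - p x] if [l = j].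
    Multilinearity of the insertion follows. *)
Lemma insert_letters_upd n j (r : {ffun 'I_n.+1 -> M}) l : (j < n.+1)%N ->
  exists m (phi : M -> M), linear phi /\ forall x,
    [ffun i : 'I_n.+2 => insert j (letters (upd r l x)) i] =
    upd [ffun i : 'I_n.+2 => insert j (letters r) i] m (phi x).
Proof.
move=> lt_j; have lt_l := ltn_ord l.
have lettersE x m : (m < n.+1)%N ->
    letters (upd r l x) m = if m == l then x else letters r m.
  by move=> mn; rewrite /letters ffunE -val_eqE /= inordK.
have [lj|jl|lj] := ltngtP l j.
- exists (widen_ord (leqnSn _) l), p; split=> [|x]; first exact: linearP.
  by insert_upd_cases lettersE.
- exists (lift ord0 l), id; split=> // x.
  by insert_upd_cases lettersE.
exists (widen_ord (leqnSn _) l), (fun x => x - p x); split=> [a x y|x].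
  by rewrite linearP scalerBr opprD addrACA.
by insert_upd_cases lettersE.
Qed.

Definition insertion_pure n (r : {ffun 'I_n.+1 -> M}) : tensor_power n.+2 M :=
  \sum_(j < n.+1) (-1) ^+ j.+1 *: word n.+2 (insert j (letters r)).

Fact insertion_pure_multilinear n : multilinear (@insertion_pure n).
Proof.
move=> r l a x y; rewrite /insertion_pure scaler_sumr -big_split.
apply: eq_bigr => j _ /=.
have [m [phi [phiP E]]] := insert_letters_upd r l (ltn_ord j).
by rewrite /word !E phiP pure_multilinear scalerDr !scalerA mulrC.
Qed.

Definition insertion n : {linear tensor_power n.+1 M -> tensor_power n.+2 M} :=
  tensor_lift (@insertion_pure_multilinear n).

Lemma insertion_word n u : insertion n (word n.+1 u) =
  \sum_(j < n.+1) (-1) ^+ j.+1 *: word n.+2 (insert j u).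
Proof.
rewrite /insertion tensor_liftE; apply: eq_bigr => j _; congr (_ *: _).
apply: eq_word => m mn; have lt_j := ltn_ord j.
have E i : (i < n.+1)%N -> letters [ffun l : 'I_n.+1 => u l] i = u i.
  by move=> h; rewrite /letters ffunE inordK.
rewrite /insert; case: ifP => [mj|_]; first by rewrite E //; lia.
case: eqP => [->|_]; first by rewrite E.
by case: eqP => // /eqP h; rewrite E //; lia.
Qed.

(** Letter [j] is split as [(u j - p (u j)) + p (u j)]; this turns face [j.+1] of insertion [j] into
    a telescoping difference. *)
Lemma word_head_map n j u : (j < n)%N ->
  word n (head_map j u) =
  word n (fun m => if m == j then u j - p (u j) else head_map j u m)
  + word n (head_map j.+1 u).
Proof.
move=> jn; apply: (wordD jn) => [|m mn mj].
  by rewrite /head_map eqxx ltnn ltnSn subrK.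
by rewrite /= (negbTE mj) /head_map ltnS (leq_eqVlt m) (negbTE mj).
Qed.

Lemma word_face_insert n i j u : (i < n.+2)%N -> (j < n.+1)%N ->
  word n.+1 (face n.+1 i (insert j u)) =
  if (i < j)%N then word n.+1 (insert j.-1 (face n i u))
  else if i == j then 0
  else if i == j.+1 then word n.+1 (head_map j u) - word n.+1 (head_map j.+1 u)
  else word n.+1 (insert j (face n i.-1 u)).
Proof.
move=> lt_i lt_j; case: ifP => [ij|ij].
  by apply: eq_word => m mn; apply: face_insert_lt => //; lia.
case: eqP => [->|/eqP nij]; first by apply: (word0 lt_j); apply: face_insert_eq.
case: eqP => [->|/eqP nij1].
  rewrite word_head_map // addrK; apply: eq_word => m mn; case: eqP => [->|/eqP mj].
    exact: face_insert_succ_diag.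
  exact: face_insert_succ.
case: i lt_i ij nij nij1 => [|i] lt_i ij nij nij1; first lia.
by apply: eq_word => m mn; apply: face_insert_gt => //; lia.
Qed.

(** The double sum is the insertion applied to the differential, written out so that degree 0, where
    it is empty, needs no separate argument. *)
Lemma insertion_diff_word n u :
  hochschild_diff M n (insertion n (word n.+1 u)) +
  \sum_(j < n) \sum_(i < n.+1) (-1) ^+ (i + j.+1) *: word n.+1 (insert j (face n i u)) =
  word n.+1 u - word n.+1 (p \o u).
Proof.
rewrite insertion_word raddf_sum /=.
pose F i j := (-1) ^+ (i + j.+1) *: word n.+1 (face n.+1 i (insert j u)).
pose G i j := (-1) ^+ (i + j.+1) *: word n.+1 (insert j (face n i u)).
transitivity (\sum_(j < n.+1) \sum_(i < n.+2) F i j + \sum_(j < n) \sum_(i < n.+1) G i j).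
  congr (_ + _); apply: eq_bigr => j _.
  rewrite linearZ /= hochschild_diff_word scaler_sumr.
  by apply: eq_bigr => i _; rewrite scalerA -exprD addnC.
rewrite (@insertion_double_sum _ n F G (fun j => word n.+1 (head_map j u))).
- by congr (_ - _); apply: eq_word => m mn; rewrite /head_map ?mn.
- move=> i [|j] /andP[ij jn] //; rewrite /F /G word_face_insert ?ij //; last lia.
  by rewrite -scaleNr addnS exprS mulN1r.
- by move=> j jn; rewrite /F word_face_insert ?ltnn ?eqxx ?scaler0 //; lia.
- move=> j jn; rewrite /F word_face_insert //.
  rewrite ifF; last lia. rewrite ifF; last lia.
  (* The sign exponent is [j.+1 + j.+1], hence even. *)
  by rewrite eqxx -signr_odd oddD addbb scale1r.
move=> i j /andP[ij jn]; rewrite /F /G word_face_insert //; try lia.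
rewrite ifF; last lia. rewrite ifF; last lia. rewrite ifF; last lia.
by rewrite -scaleNr addSn exprS mulN1r.
Qed.

Lemma insertion_homotopy0 (x : tensor_power 1 M) :
  x - tensor_map 1 p x = hochschild_diff M 0 (insertion 0 x).
Proof.
apply: (@tensor_linear_eq _ _ _ _ (idfun \- tensor_map 1 p)
  (hochschild_diff M 0 \o insertion 0)) => r /=.
rewrite pure_letters tensor_map_word -insertion_diff_word big_ord0.
by rewrite addr0.
Qed.

Lemma insertion_homotopyS n (x : tensor_power n.+2 M) :
  x - tensor_map n.+2 p x =
  hochschild_diff M n.+1 (insertion n.+1 x) + insertion n (hochschild_diff M n x).
Proof.
apply: (@tensor_linear_eq _ _ _ _ (idfun \- tensor_map n.+2 p)
  ((hochschild_diff M n.+1 \o insertion n.+1)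
    \+ (insertion n \o hochschild_diff M n))) => r /=.
rewrite pure_letters tensor_map_word -insertion_diff_word; congr (_ + _).
rewrite hochschild_diff_word raddf_sum exchange_big /=; apply: eq_bigr => i _.
rewrite linearZ /= insertion_word scaler_sumr; apply: eq_bigr => j _.
by rewrite scalerA exprD.
Qed.

(** Every inserted word contains a letter [u j - p (u j)], which [f] sends to zero. *)
Lemma tensor_map_insertion (S : lmodType k) (f : {linear M -> S}) n x :
  (forall y, f (p y) = f y) -> tensor_map n.+2 f (insertion n x) = 0.
Proof.
move=> fp; pose z : {linear tensor_power n.+1 M -> tensor_power n.+2 S} := \0.
apply: (@tensor_linear_eq _ _ _ _ (tensor_map n.+2 f \o insertion n) z) => r /=.
rewrite pure_letters insertion_word raddf_sum big1 // => j _ /=.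
rewrite linearZ /= tensor_map_word (@word0 _ _ _ _ j) ?scaler0 //.
  by have := ltn_ord j; lia.
by rewrite /= /insert ltnn eqxx linearB /= fp subrr.
Qed.

End Insertion.

(** * Functoriality of tensor powers *)

Section TensorMapComposition.
Variables (k : comNzRingType) (n : nat) (R S T : lmodType k).

Lemma tensor_map_comp (f : {linear R -> S}) (g : {linear S -> T})
    (h : {linear R -> T}) : (forall x, g (f x) = h x) ->
  forall x, tensor_map n g (tensor_map n f x) = tensor_map n h x.
Proof.
move=> gf; apply: (@tensor_linear_eq _ _ _ _ (tensor_map n g \o tensor_map n f)) => r.
rewrite /= !tensor_mapE; congr pure; apply/ffunP=> i; rewrite !ffunE; exact: gf.
Qed.

Lemma tensor_map_id (f : {linear R -> R}) :
  (forall x, f x = x) -> forall x, tensor_map n f x = x.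
Proof.
move=> f1; apply: (@tensor_linear_eq _ _ _ _ _ idfun) => r.
by rewrite tensor_mapE; congr pure; apply/ffunP=> i; rewrite !ffunE f1.
Qed.

End TensorMapComposition.

(** * The inclusion of [B] in a row extension and the induced idempotent of [M] *)

Section RowInclusion.
Variables (k : comNzRingType) (B M : nuAlgType k) (X : row_extension B M).

Lemma row_iso_incl b : row_iso X (row_incl X b) = (b, 0).
Proof. exact: row_invK. Qed.

Lemma nuactr0 (I : nuLmodType B) (b : B) : nuact b (0 : I) = 0.
Proof. by have := nuact_linr (-1) b (0 : I) 0; rewrite scaler0 addr0 scaleN1r addNr. Qed.

Fact row_incl_linear : linear (row_incl X).
Proof.
move=> a x y; apply: (can_inj (row_isoK X)); rewrite linearP /= !row_iso_incl.
by congr pair; rewrite /= scaler0 addr0.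
Qed.

HB.instance Definition _ :=
  GRing.isLinear.Build k B M _ (row_incl X) row_incl_linear.

Fact row_incl_mul : {morph row_incl X : x y / x ** y}.
Proof.
move=> x y; apply: (can_inj (row_isoK X)); rewrite nuhomM !row_iso_incl.
by congr pair; rewrite /= nuactr0.
Qed.

Definition row_incl_hom : nuAlgHom B M := @NUAlgHom k B M (row_incl X) row_incl_mul.

Lemma row_epsK b : row_eps X (row_incl X b) = b.
Proof. by rewrite /= row_iso_incl. Qed.

Definition row_retraction_fun : {linear M -> M} := row_incl X \o row_eps X.

Fact row_retraction_mul : {morph row_retraction_fun : x y / x ** y}.
Proof.
move=> x y; rewrite /= -row_incl_mul; congr (row_incl X _).
exact: (nuhomM (row_eps X)).
Qed.

Definition row_retraction : nuAlgHom M M := NUAlgHom row_retraction_mul.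

(** A product of row matrices depends on its left factor only through the [B] component, which the
    retraction preserves. *)
Lemma row_retraction_mull (x y : M) : row_retraction x ** y = x ** y.
Proof.
apply: (can_inj (row_isoK X)); rewrite !nuhomM /= row_iso_incl.
by case: (row_iso X x).
Qed.

End RowInclusion.

Theorem theorem3p4 (k : fieldType) (B : nuAlgType k) (e : B)
    (M : nuAlgType k) (X : row_extension B M) :
  left_unit e ->
  left_unitary X e ->
  let phi : chain_map (hochschild M) (hochschild B) :=
    hochschild_map (row_eps X) in
  [/\ degreewise_surjective phi,
      graded_split phi,
      contractible (ker_complex phi)
    & chain_homotopy_equivalence phi].
Proof.
move=> _ eM phi; pose s := hochschild_map (row_incl_hom X).
pose p := row_retraction X; have pM := @row_retraction_mull _ _ _ X.
have sK n : cancel (s n) (phi n).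
  move=> x; rewrite /= (tensor_map_comp (h := idfun)) => [|y]; last exact: row_epsK.
  exact: tensor_map_id.
have sphi n x : s n (phi n x) = tensor_map n.+1 p x by apply: tensor_map_comp.
pose h n : {linear hochschild M n -> hochschild M n.+1} :=
  insertion (row_incl X e) p n.
(* The left unit of [M] that the homotopy inserts is [row_incl X e], by [eM]. *)
have h0 x : x - s 0%N (phi 0%N x) = diff (hochschild M) 0 (h 0%N x).
  by rewrite sphi; apply: insertion_homotopy0.
have hS n x : x - s n.+1 (phi n.+1 x) =
    diff (hochschild M) n.+1 (h n.+1 x) + h n (diff (hochschild M) n x).
  by rewrite sphi; apply: insertion_homotopyS.
have phih n x : phi n.+1 (h n x) = 0.
  by apply: tensor_map_insertion => y; apply: row_epsK.
split.
- exact: section_surjective sK.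
- exact: section_graded_split sK.
- exact: ker_contractible h0 hS phih.
exact: section_homotopy_equivalence sK h0 hS.
Qed.
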